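(* Let $f:\underline{X}\to\underline{Y}$ be a function, where $\underline{X}$ is a metrisable strongly zero-dimensional space, and suppose $\gamma=\operatorname{Lev}^2(f)$ exists and is a countable limit ordinal. Let $(\gamma_n)_{n\in\mathbb{N}}$ be a sequence of ordinals with $\gamma_n\leq\gamma$ for all $n$ and $\lim_{n\to\infty}\gamma_n=\gamma$ (i.e. for every $\alpha<\gamma$, $\gamma_n>\alpha$ for all sufficiently large $n$). Let $L_n=\mathcal{L}^2_{\gamma_n}(f)$ and let $f_n$ be the restriction of $f$ to $X\setminus L_n$. Then $f\equiv_2\lceil f_n\rceil_{n\in\mathbb{N}}$.
   Context: A topological space is strongly zero-dimensional metrisable if its topology is induced by a metric whose range is contained in $\{0\}\cup\{2^{-n}\mid n\in\mathbb{N}\}$. For $f:\underline{X}\to\underline{Y}$: $\mathcal{L}^2_0(f)=X$, $\mathcal{L}^2_{\alpha+1}(f)=cl\{x\in\mathcal{L}^2_\alpha(f)\mid f|_{\mathcal{L}^2_\alpha(f)}\text{ is discontinuous at }x\}$ (subspace topology, closure in $X$), $\mathcal{L}^2_\lambda(f)=cl\bigcap_{\alpha<\lambda}\mathcal{L}^2_\alpha(f)$ for limit $\lambda$; $\operatorname{Lev}^2(f)=\min\{\alpha\mid\mathcal{L}^2_\alpha(f)=\emptyset\}$. A partial function is continuous if continuous on its domain with the subspace topology. For functions $g:\underline{X}_1\to\underline{Y}_1$, $h:\underline{X}_2\to\underline{Y}_2$, $g\leq_2 h$ means there are continuous partial $F:\subseteq\underline{X}_1\times\underline{Y}_2\to\underline{Y}_1$,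 $G:\subseteq\underline{X}_1\to\underline{X}_2$ with $g(x)=F(x,h(G(x)))$ (all defined) for all $x\in X_1$; $g\equiv_2 h$ means $g\leq_2 h$ and $h\leq_2 g$. Each $f_n$ has domain $X\setminus L_n$ with the subspace topology; the coproduct $\coprod_n\underline{A}_n=\bigcup_n\{n\}\times A_n$ carries the smallest topology containing all $\{n\}\times U$, $U$ open in $\underline{A}_n$, and $\lceil f_n\rceil_{n\in\mathbb{N}}(n,x)=(n,f_n(x))$ maps $\coprod_n(X\setminus L_n)$ to $\coprod_n\underline{Y}$. *)

(* Defs.v *)
From HB Require Import structures.
From mathcomp Require Import all_boot all_order all_algebra.
From mathcomp Require Import all_classical all_reals topology.

Set Implicit Arguments.
Unset Strict Implicit.
Unset Printing Implicit Defensive.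

Import Order.TTheory GRing.Theory Num.Theory.

Local Open Scope classical_set_scope.
Local Open Scope ring_scope.

Definition is_metric (R : realType) (X : Type) (dist : X -> X -> R) : Prop :=
  [/\ forall x y, 0 <= dist x y,
      forall x y, dist x y = 0 <-> x = y,
      forall x y, dist x y = dist y x &
      forall x y z, dist x z <= dist x y + dist y z].

Definition induces_topology (R : realType) (X : topologicalType)
    (dist : X -> X -> R) : Prop :=
  forall U : set X, open U <->
    forall x, U x -> exists2 e : R, 0 < e & [set y | dist x y < e] `<=` U.

Definition strongly_zero_dim_metrisable (R : realType) (X : topologicalType)
    : Prop :=
  exists dist : X -> X -> R,
    [/\ is_metric dist, induces_topology dist &
        forall x y, dist x y = 0 \/ exists n : nat, dist x y = 2 ^- n].

(* An ordinal is represented as an element of a well-ordered type O, standing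
   for the order type of the initial segment below it; every ordinal g arises
   this way, e.g. as the top element of a copy of g + 1. All notions below
   depend only on initial segments of O. *)
Section Ordinals.
Context {d : Order.disp_t} {O : orderType d}.
Implicit Types a b : O.

Definition well_ordered : Prop := well_founded (fun a b => (a < b)%O).

Definition is_zero a : Prop := forall b, (a <= b)%O.

Definition is_succ b a : Prop :=
  (b < a)%O /\ forall c, (b < c)%O -> (a <= c)%O.

Definition is_limit a : Prop := ~ is_zero a /\ forall b, ~ is_succ b a.

End Ordinals.
Arguments well_ordered {d} O.

Section Level.
Context {d : Order.disp_t} {O : orderType d} (wfO : well_ordered O).
Context {X Y : topologicalType} (f : X -> Y).

(* A : set X used as a type is the subtype of its elements, which carries the
   subspace topology. *)
Definition restr (A : set X) : A -> Y := fun u => f (\val u).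

Definition discontinuities (A : set X) : set X :=
  [set \val u | u in [set u : A | ~ {for u, continuous (restr (A := A))}]].

(* The three disjuncts are mutually exclusive, cf. level2_zero, level2_succ
   and level2_limit below. *)
Definition level2_step (a : O) (L : forall b, (b < a)%O -> set X) : set X :=
  [set x | [\/ is_zero a,
      exists b (ba : (b < a)%O),
        is_succ b a /\ closure (discontinuities (L b ba)) x |
      is_limit a /\
        closure [set z | forall b (ba : (b < a)%O), L b ba z] x]].

Definition level2 : O -> set X := Fix wfO (fun=> set X) level2_step.

Lemma level2E a : level2 a = level2_step (fun b (_ : (b < a)%O) => level2 b).
Proof.
rewrite /level2 Fix_eq// => b L L' LL'; congr level2_step.
by apply: functional_extensionality_dep => c; apply/funext => cb; exact: LL'.
Qed.

Lemma level2_zero a : is_zero a -> level2 a = setT.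
Proof. by move=> a0; rewrite level2E -subTset => x _; exact: Or31. Qed.

Lemma is_succ_nonzero (a b : O) : is_succ b a -> ~ is_zero a.
Proof. by move=> [ba _] /(_ b); rewrite leNgt ba. Qed.

Lemma is_succ_inj (a b c : O) : is_succ b a -> is_succ c a -> b = c.
Proof.
move=> [ba bmin] [ca cmin]; case: (ltgtP b c) => //.
- by move/bmin; rewrite leNgt ca.
- by move/cmin; rewrite leNgt ba.
Qed.

Lemma level2_succ a b : is_succ b a ->
  level2 a = closure (discontinuities (level2 b)).
Proof.
move=> ba; rewrite level2E; apply/seteqP; split => x.
- case=> [a0|[c [ca [sca]]]|[[_ /(_ b)]//]].
  + by have := is_succ_nonzero ba a0.
  + by rewrite (is_succ_inj ba sca).
- by move=> bx; apply: Or32; exists b, (proj1 ba).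
Qed.

Lemma level2_limit a : is_limit a ->
  level2 a = closure (\bigcap_(b in [set b | (b < a)%O]) level2 b).
Proof.
move=> la; rewrite level2E; apply/seteqP; split => x.
- by case=> [a0|[c [ca [sca]]]|[]//]; [case: la | case: la => _ /(_ c)].
- by move=> ax; apply: Or33; split.
Qed.

Definition is_Lev2 (a : O) : Prop :=
  level2 a = set0 /\ forall b, level2 b = set0 -> (a <= b)%O.

End Level.

(* F and G are partial functions, defined on the subspaces DF and DG. *)
Definition le2 {X1 Y1 X2 Y2 : topologicalType} (g : X1 -> Y1) (h : X2 -> Y2)
    : Prop :=
  exists (DF : set (X1 * Y2)) (F : DF -> Y1) (DG : set X1) (G : DG -> X2),
    [/\ continuous F, continuous G &
        forall x : X1, exists (u : DG) (v : DF),
          [/\ \val u = x, \val v = (x, h (G u)) & g x = F v]].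

Definition equiv2 {X1 Y1 X2 Y2 : topologicalType}
    (g : X1 -> Y1) (h : X2 -> Y2) : Prop :=
  le2 g h /\ le2 h g.

(* The library topology on {n & A n} is the coproduct topology. *)
Definition coprod_fun {A B : nat -> topologicalType}
    (g : forall n, A n -> B n) : {n : nat & A n} -> {n : nat & B n} :=
  fun u => existT _ (projT1 u) (g (projT1 u) (projT2 u)).

(* Main.v *)
Require Import Defs.
From HB Require Import structures.
From mathcomp Require Import all_boot all_order all_algebra.
From mathcomp Require Import all_classical all_reals topology.
From mathcomp Require Import lra.

Import Order.TTheory GRing.Theory Num.Theory.

Local Open Scope classical_set_scope.
Local Open Scope ring_scope.

(** The levels of [f] form a decreasing family of closed sets, and since [gamma]
  is a limit whose level is empty, the open sets [~` L_n] cover [X].  For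
  [f <= coprod f_n] it suffices to choose, locally constantly in [x], an index
  [n] with [x] outside [L_n].  A metric with values in [{0} u {2^-n}] need not
  be an ultrametric, but "having the same closed ball of radius [2^-a]" is an
  equivalence relation with open classes, the classes shrink as [a] grows and
  they form a base; the index is then the least [n] such that the largest class
  of [x] inside some [~` L_m] lies in [~` L_n].  The converse reduction forgets
  and restores the index. *)

(** * Locally constant selections from countable open covers *)

Section DyadicMetric.
Context {R : realType} {X : topologicalType} (dist : X -> X -> R).
Hypothesis dist_metric : is_metric dist.
Hypothesis dist_top : induces_topology dist.
Hypothesis dist_dyadic :
  forall x y, dist x y = 0 \/ exists n : nat, dist x y = 2 ^- n.

Definition same_ball (a : nat) (x y : X) : Prop :=
  forall z, dist x z <= 2 ^- a <-> dist y z <= 2 ^- a.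

Let invX2_gt0 a : 0 < 2 ^- a :> R.
Proof. by rewrite invr_gt0 exprn_gt0. Qed.

Let invX2S a : 2 ^- a = 2 * 2 ^- a.+1 :> R.
Proof. by rewrite exprS invfM mulrA divff ?mul1r ?pnatr_eq0. Qed.

Let distC x y : dist x y = dist y x.
Proof. by case: dist_metric. Qed.

Let dist_triangle y x z : dist x z <= dist x y + dist y z.
Proof. by case: dist_metric. Qed.

Let distxx x : dist x x = 0.
Proof. by case: dist_metric => _ d0 _ _; apply/d0. Qed.

(** No value of the metric lies strictly between [2 ^- a] and its double. *)
Lemma dist_gap a x y : dist x y < 2 * 2 ^- a -> dist x y <= 2 ^- a.
Proof.
case: (dist_dyadic x y) => [->|[n ->]]; first by rewrite ltW.
move=> lt_na; have [le_an|lt_na'] := leqP a n.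
  by rewrite lef_pV2 ?posrE ?exprn_gt0// ler_weXn2l// ler1n.
have : 2 * 2 ^- a <= 2 ^- n :> R.
  rewrite [leRHS]invX2S ler_pM2l// lef_pV2 ?posrE ?exprn_gt0//.
  by rewrite ler_weXn2l// ler1n.
by rewrite leNgt lt_na.
Qed.

(** Substitute for the ultrametric inequality, at the cost of one index: the triangle inequality
    gives at most [3 * 2 ^- a.+1], which is below [2 * 2 ^- a], and the gap lowers this to
    [2 ^- a]. *)
Let dist_stepS {a x y z} :
  dist x y <= 2 ^- a.+1 -> dist x z <= 2 ^- a -> dist y z <= 2 ^- a.
Proof.
move=> xy xz; apply: dist_gap; have := dist_triangle x y z.
by rewrite (distC y x); have := invX2S a; have := invX2_gt0 a; lra.
Qed.

Lemma dist_same_ball {a x y} : dist x y <= 2 ^- a.+1 -> same_ball a x y.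
Proof.
by move=> xy z; split; apply: dist_stepS; rewrite // distC.
Qed.

Lemma same_ball_dist {a x y} : same_ball a x y -> dist x y <= 2 ^- a.
Proof. by move=> /(_ y) ->; rewrite distxx ltW. Qed.

Lemma same_ball_leq {a b x y} : (b <= a)%N -> same_ball a x y -> same_ball b x y.
Proof.
elim: a => [|a IHa]; first by rewrite leqn0 => /eqP ->.
rewrite leq_eqVlt => /predU1P[->//|]; rewrite ltnS => ba xy.
by apply: IHa => //; exact/dist_same_ball/same_ball_dist.
Qed.

Lemma nbhs_same_ball a x : \forall y \near x, same_ball a x y.
Proof.
pose B := [set y | dist x y < 2 ^- a.+1].
have oB : open B.
  apply/dist_top => y By; exists (2 ^- a.+1 - dist x y); first by rewrite subr_gt0.
  by move=> z /= yz; rewrite /B/=; have := dist_triangle y x z; lra.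
apply: (filterS _ (open_nbhs_nbhs _)); last by split; [exact: oB|rewrite /B/= distxx].
by move=> y /ltW; exact: dist_same_ball.
Qed.

Lemma open_same_ball {U : set X} {x} :
  open U -> U x -> exists a, same_ball a x `<=` U.
Proof.
move=> /dist_top + Ux => /(_ _ Ux)[e e0 eU].
(* With [b] this bound, [2 ^ b > b > e^-1], so the class at index [b] has radius [2 ^- b < e]. *)
exists (Num.bound e^-1) => y /same_ball_dist xy; apply: eU => /=.
apply: (le_lt_trans xy); rewrite -[ltRHS]invrK ltf_pV2 ?posrE ?invr_gt0 ?exprn_gt0//.
apply: (lt_trans (archi_boundP _)); first by rewrite invr_ge0 ltW.
by rewrite -natrX ltr_nat ltn_expl.
Qed.

(** Points equivalent at index [a] have identical classes at every coarser index [b]. *)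
Let same_ball_subset {a b x y} {U : set X} : (b <= a)%N -> same_ball a x y ->
  same_ball b x `<=` U <-> same_ball b y `<=` U.
Proof.
move=> ba /(same_ball_leq ba) xy; have -> // : same_ball b x = same_ball b y.
apply/funext => z; apply/propext; split=> + w.
- by move=> /(_ w) <-; rewrite xy.
- by move=> /(_ w) <-; rewrite xy.
Qed.

Lemma dyadic_cover_selection (U : nat -> set X) :
  (forall n, open (U n)) -> (forall x, exists n, U n x) ->
  exists s : X -> nat,
    (forall x, U (s x) x) /\ (forall x, \forall y \near x, s y = s x).
Proof.
move=> oU covU.
(* Lexicographic minimality: [a] is least such that the class of [x] fits in some member of the
   cover, and [n] is then the least such member. *)
pose least x a n := [/\ same_ball a x `<=` U n,
  forall b m, (b < a)%N -> ~ same_ball b x `<=` U m &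
  forall m, (m < n)%N -> ~ same_ball a x `<=` U m].
have ex_least x : exists n a, least x a n.
  have exa : exists a, `[< exists n, same_ball a x `<=` U n >].
    by have [n /(open_same_ball (oU n))[a aU]] := covU x; exists a; apply/asboolP; exists n.
  case: (ex_minnP exa) => a /asboolP aU amin.
  have exn : exists n, `[< same_ball a x `<=` U n >].
    by case: aU => n nU; exists n; apply/asboolP.
  case: (ex_minnP exn) => n /asboolP nU nmin; exists n, a; split=> //.
  - move=> b m ba bU; have /amin : `[< exists n, same_ball b x `<=` U n >].
      by apply/asboolP; exists m.
    by rewrite leqNgt ba.
  - by move=> m mn /asboolP/nmin; rewrite leqNgt mn.
have least_uniq x a n b m : least x a n -> least x b m -> n = m.
  move=> [aU amin nmin] [bU bmin mmin]; case: (ltngtP a b) => ab.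
  - by case: (bmin _ _ ab aU).
  - by case: (amin _ _ ab bU).
  move: ab bU mmin => <- bU mmin; case: (ltngtP n m) => // nm.
  - by case: (mmin _ nm aU).
  - by case: (nmin _ nm bU).
have [s sP] := choice ex_least; exists s; split=> x.
  by have [a [aU _ _]] := sP x; exact: aU.
have [a [aU amin nmin]] := sP x.
(* Minimality of [(a, n)] involves only the classes at indices up to [a], which [x] and [y] share;
   hence the same pair is minimal for [y]. *)
apply: filterS (nbhs_same_ball a x) => y xy.
have [b least_y] := sP y; apply: (least_uniq _ _ _ _ _ least_y).
split=> [|c m ca|m mn].
- exact/(same_ball_subset (leqnn a) xy).
- by move=> /(same_ball_subset (ltnW ca) xy); exact: amin.
- by move=> /(same_ball_subset (leqnn a) xy); exact: nmin.
Qed.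

End DyadicMetric.

(** * The levels are closed and decreasing *)

Section LevelMonotonicity.
Context {d : Order.disp_t} {O : orderType d} (wfO : well_ordered O).
Context {X Y : topologicalType} (f : X -> Y).

Lemma ordinal_cases (a : O) : [\/ is_zero a, exists b, is_succ b a | is_limit a].
Proof.
have [a0|a0] := pselect (is_zero a); first exact: Or31.
have [sa|sa] := pselect (exists b, is_succ b a); first exact: Or32.
by apply: Or33; split=> // b ba; apply: sa; exists b.
Qed.

Lemma level2_closed a : closed (level2 wfO f a).
Proof.
case: (ordinal_cases a) => [a0|[b ba]|la].
- by rewrite level2_zero//; exact: closedT.
- by rewrite (level2_succ wfO f ba); exact: closed_closure.
- by rewrite level2_limit//; exact: closed_closure.
Qed.

(** By transfinite induction: a later level is the closure of a subset of an earlier level, which is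
    already closed. *)
Lemma level2_anti a b : (b <= a)%O -> level2 wfO f a `<=` level2 wfO f b.
Proof.
elim/(well_founded_ind wfO): a => a IHa; rewrite le_eqVlt => /predU1P[->//|ba].
case: (ordinal_cases a) => [/(_ b)|[c ca]|la]; first by rewrite leNgt ba.
- have bc : (b <= c)%O by rewrite leNgt; apply/negP => /(proj2 ca); rewrite leNgt ba.
  apply: subset_trans (IHa c (proj1 ca) bc); rewrite (level2_succ wfO f ca).
  rewrite [X in _ `<=` X](proj1 (closure_id _) (level2_closed c)).
  by apply: closureS => _ [u _ <-]; exact: set_valP.
- rewrite (level2_limit wfO f la).
  rewrite [X in _ `<=` X](proj1 (closure_id _) (level2_closed b)).
  by apply: closureS => x /(_ b ba).
Qed.

End LevelMonotonicity.

(** * Reductions between [f] and a coproduct of its restrictions *)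

Lemma le2_total {X1 Y1 X2 Y2 : topologicalType} (g : X1 -> Y1) (h : X2 -> Y2)
    (F : X1 * Y2 -> Y1) (G : X1 -> X2) :
  continuous F -> continuous G -> (forall x, g x = F (x, h (G x))) -> le2 g h.
Proof.
move=> cF cG gE.
have cval (T : topologicalType) : continuous (\val : [set: T] -> T).
  exact: initial_continuous.
exists setT, (F \o \val), setT, (G \o \val); split.
- by move=> u; apply: continuous_comp; [exact: cval|exact: cF].
- by move=> u; apply: continuous_comp; [exact: cval|exact: cG].
move=> x.
have xT : x \in [set: X1] by rewrite inE.
have yT : (x, h (G x)) \in [set: X1 * Y2] by rewrite inE.
by exists (SigSub xT), (SigSub yT).
Qed.

Section Coproduct.
Context {X Y : topologicalType} (f : X -> Y) (A : nat -> set X).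

Lemma coprod_restr_le2 :
  le2 (coprod_fun (A := fun n => (A n : topologicalType)) (B := fun=> Y)
         (fun n => restr f (A := A n))) f.
Proof.
pose T : topologicalType := {n : nat & (A n : topologicalType)}.
pose G (u : T) : X := \val (projT2 u).
pose F (v : T * Y) : {n : nat & Y} := existT (fun=> Y) (projT1 v.1) v.2.
apply: (@le2_total _ _ _ _ _ _ F G) => //.
- case=> [[n x] y] W /= nW.
  (* The index is locally constant on a coproduct, so it can be frozen at [n]. *)
  exists ([set u | projT1 u = n], [set z | W (existT (fun=> Y) n z)]).
    by split=> //=; rewrite /nbhs/= /sigT_nbhs/=; exact: filterE.
  by case=> [[m t] z] [/= mn Wz]; rewrite /F/= mn.
- by case=> n x W nW; exact: (@initial_continuous _ _ (\val : A n -> X) x W nW).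
Qed.

Lemma le2_coprod_restr (s : X -> nat) :
  (forall x, A (s x) x) -> (forall x, \forall y \near x, s y = s x) ->
  le2 f (coprod_fun (A := fun n => (A n : topologicalType)) (B := fun=> Y)
           (fun n => restr f (A := A n))).
Proof.
move=> As cs.
pose T : topologicalType := {n : nat & (A n : topologicalType)}.
pose G (x : X) : T := existT _ (s x) (SigSub (mem_set (As x))).
pose F (v : X * {n : nat & Y}) : Y := projT2 v.2.
apply: (@le2_total _ _ _ _ _ _ F G) => //.
- case=> x [n y] W /= nW; exists (setT, [set u | W (projT2 u)]).
    by split; [exact: filterT|].
  by case=> z u [_].
- move=> x W [_ [[V oV <-] Vx] VW].
  have nV : nbhs x V by exact: open_nbhs_nbhs.
  apply: filterS2 (cs x) nV => y; rewrite /G/=.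
  (* The membership proof depends on [s y], so it is generalised before [s y] becomes [s x]; then
     [G y] lies in the same summand as [G x]. *)
  move: (As y) => + sy; rewrite sy => Ay Vy.
  exact: VW.
Qed.

End Coproduct.

Theorem theorem6p3 (R : realType) (d : Order.disp_t) (O : orderType d)
    (wfO : well_ordered O) (X Y : topologicalType) (f : X -> Y)
    (gamma : O) (gamma_ : nat -> O) :
  strongly_zero_dim_metrisable R X ->
  is_Lev2 wfO f gamma ->
  is_limit gamma ->
  countable [set a : O | (a < gamma)%O] ->
  (forall n : nat, (gamma_ n <= gamma)%O) ->
  (forall a : O, (a < gamma)%O ->
    exists N : nat, forall n : nat, (N <= n)%N -> (a < gamma_ n)%O) ->
  equiv2 f
    (coprod_fun (A := fun n => (~` level2 wfO f (gamma_ n) : set X))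
                (B := fun=> Y)
                (fun n => restr f (A := ~` level2 wfO f (gamma_ n)))).
Proof.
move=> [dist [dm dt dd]] [L0 _] lim_gamma _ _ gamma_lim.
split; last exact: coprod_restr_le2.
have [||s [sL s_cst]] :=
    @dyadic_cover_selection _ _ dist dm dt dd (fun n => ~` level2 wfO f (gamma_ n)).
- by move=> n; apply/closed_openC/level2_closed.
- move=> x.
  have [a a_gamma nax] : exists2 a, (a < gamma)%O & ~ level2 wfO f a x.
    (* A point in all levels below the limit [gamma] would lie in the level at [gamma], which is
       empty. *)
    apply/not_exists2P => Lx.
    have : level2 wfO f gamma x.
      rewrite level2_limit//; apply: subset_closure => a /= a_gamma.
      by case: (Lx a) => // /contrapT.
    by rewrite L0.
  have [N /(_ N (leqnn N)) aN] := gamma_lim a a_gamma.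
  by exists N => /(level2_anti wfO f _ _ (ltW aN)).
- exact: (le2_coprod_restr f (fun n => ~` level2 wfO f (gamma_ n)) s).
Qed.
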